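(* Let $h=(h_{ijk})_{1\le i,j,k\le3}$ be a symmetric trace-free cubic form on a Euclidean three-space. With $S_{ij}=\sum_{a,b}h_{abi}h_{abj}$, $s=\operatorname{tr}S$, $q=\operatorname{tr}(S^2)$ and $r=\operatorname{tr}(S^3)$, one has $$s^3+3sq-10r\ge0,$$ $$-4s^3+17sq-15r\ge0 .$$
   Context: The components $h_{ijk}$ are real, taken with respect to an orthonormal basis, totally symmetric in $i,j,k$, and trace-free means $\sum_ih_{iik}=0$ for every $k$. $S=(S_{ij})$ is the resulting symmetric $3\times3$ matrix. *)

(* Defs.v *)
From mathcomp Require Import all_boot all_order all_algebra.
From mathcomp Require Import reals.
Set Implicit Arguments.
Unset Strict Implicit.
Unset Printing Implicit Defensive.
Import Order.TTheory GRing.Theory Num.Theory.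
Local Open Scope ring_scope.

(* h i j k is the component h_{ijk} in an orthonormal basis of R^3. *)
Definition cubic_components (R : realType) : Type := 'I_3 -> 'I_3 -> 'I_3 -> R.

(* Invariance under the transpositions (1 2) and (2 3), which generate the
   permutations of the three slots. *)
Definition totally_symmetric (R : realType) (h : cubic_components R) : Prop :=
  forall i j k : 'I_3, h i j k = h j i k /\ h i j k = h i k j.

Definition trace_free (R : realType) (h : cubic_components R) : Prop :=
  forall k : 'I_3, \sum_(i < 3) h i i k = 0.

Definition S_mx (R : realType) (h : cubic_components R) : 'M[R]_3 :=
  \matrix_(i < 3, j < 3) \sum_(a < 3) \sum_(b < 3) h a b i * h a b j.

(* Main.v *)
Require Import Defs.
From mathcomp Require Import all_boot all_order all_algebra.
From mathcomp Require Import reals ring.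
Import Order.TTheory GRing.Theory Num.Theory.
Local Open Scope ring_scope.

(** Write [h(x,x)] for the vector with entries [sum_(j,k) h_ijk x_j x_k], put
    [v_k = sum_(i,j) S_ij h_ijk], and give forms in [x] the rotation-invariant
    norm [|f|^2 = sum (coefficient)^2 / (multinomial coefficient)]. Then
    [-4 s^3 + 17 s q - 15 r = 12 |det(x, S x, h(x,x))|^2].

    The other cubic vanishes when [h] is zonal and when [h] is
    [x1^3 - 3 x1 x2^2], and no equivariant form of degree 3 in [h] vanishes at
    both, so it is not itself a sum of squares. It becomes one after
    multiplication by [s >= 0]:
    [s (s^3 + 3 s q - 10 r) = 837/80 |det(x, v, h(x,x))|^2 + 1/60 |Y|^2],
    where [Y] is the harmonic part of
    [20 (x.Sx)^2 + 17 (v.x) h(x,x,x) - 20 s |h(x,x)|^2], whose coefficients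
    20, 17, -20 are forced up to scale by the vanishing of [Y] at the two zeros.
    If [s = 0] then [h = 0]. *)

(** * Sum-of-squares identities in coordinates *)

Ltac sos_step :=
  first [exact: sqr_ge0 | exact: ler0n | apply: addr_ge0 | apply: mulr_ge0].

(* [w_ijkl] are the coefficients of the quartic [det(x, S x, h(x,x))]. *)
Lemma second_inequality_coords {R : realFieldType}
    {h111 h112 h113 h122 h123 h133 h222 h223 h233 h333 S11 S12 S13 S22 S23 S33
     s q r w1111 w1112 w1113 w1122 w1123 w1133 w1222 w1223 w1233 w1333 w2222
     w2223 w2233 w2333 w3333 : R} :
  h111 = - (h122 + h133) ->
  h222 = - (h112 + h233) ->
  h333 = - (h113 + h223) ->
  S11 = h111 ^+ 2 + 2 * h112 ^+ 2 + 2 * h113 ^+ 2 + h122 ^+ 2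
    + 2 * h123 ^+ 2 + h133 ^+ 2 ->
  S12 = h111 * h112 + 2 * h112 * h122 + 2 * h113 * h123 + h122 * h222
    + 2 * h123 * h223 + h133 * h233 ->
  S13 = h111 * h113 + 2 * h112 * h123 + 2 * h113 * h133 + h122 * h223
    + 2 * h123 * h233 + h133 * h333 ->
  S22 = h112 ^+ 2 + 2 * h122 ^+ 2 + 2 * h123 ^+ 2 + h222 ^+ 2
    + 2 * h223 ^+ 2 + h233 ^+ 2 ->
  S23 = h112 * h113 + 2 * h122 * h123 + 2 * h123 * h133 + h222 * h223
    + 2 * h223 * h233 + h233 * h333 ->
  S33 = h113 ^+ 2 + 2 * h123 ^+ 2 + 2 * h133 ^+ 2 + h223 ^+ 2
    + 2 * h233 ^+ 2 + h333 ^+ 2 ->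
  s = S11 + S22 + S33 ->
  q = S11 ^+ 2 + S22 ^+ 2 + S33 ^+ 2 + 2 * (S12 ^+ 2 + S13 ^+ 2
    + S23 ^+ 2) ->
  r = S11 ^+ 3 + S22 ^+ 3 + S33 ^+ 3 + 3 * (S11 * (S12 ^+ 2
    + S13 ^+ 2) + S22 * (S12 ^+ 2 + S23 ^+ 2) + S33 * (S13 ^+ 2
    + S23 ^+ 2)) + 6 * S12 * S13 * S23 ->
  w1111 = S12 * h113 - S13 * h112 ->
  w1112 = - S11 * h113 + 2 * S12 * h123 + S13 * h111 - 2 * S13 * h122
    + S22 * h113 - S23 * h112 ->
  w1113 = S11 * h112 - S12 * h111 + 2 * S12 * h133 - 2 * S13 * h123
    + S23 * h113 - S33 * h112 ->
  w1122 = - 2 * S11 * h123 - S12 * h113 + S12 * h223 + 2 * S13 * h112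
    - S13 * h222 + 2 * S22 * h123 + S23 * h111 - 2 * S23 * h122 ->
  w1123 = 2 * S11 * h122 - 2 * S11 * h133 - S12 * h112
    + 2 * S12 * h233 + S13 * h113 - 2 * S13 * h223 - S22 * h111
    + 2 * S22 * h133 + S33 * h111 - 2 * S33 * h122 ->
  w1133 = 2 * S11 * h123 - 2 * S12 * h113 + S12 * h333 + S13 * h112
    - S13 * h233 - S23 * h111 + 2 * S23 * h133 - 2 * S33 * h123 ->
  w1222 = - S11 * h223 - 2 * S12 * h123 + S13 * h122 + S22 * h223
    + 2 * S23 * h112 - S23 * h222 ->
  w1223 = S11 * h222 - 2 * S11 * h233 + S12 * h122 - 2 * S12 * h133
    - 2 * S22 * h112 + 2 * S22 * h233 + 2 * S23 * h113 - S23 * h223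
    + 2 * S33 * h112 - S33 * h222 ->
  w1233 = 2 * S11 * h223 - S11 * h333 + 2 * S13 * h122 - S13 * h133
    - 2 * S22 * h113 + S22 * h333 - 2 * S23 * h112 + S23 * h233
    + 2 * S33 * h113 - 2 * S33 * h223 ->
  w1333 = S11 * h233 - S12 * h133 + 2 * S13 * h123 - 2 * S23 * h113
    + S23 * h333 - S33 * h233 ->
  w2222 = - S12 * h223 + S23 * h122 ->
  w2223 = S12 * h222 - 2 * S12 * h233 - S13 * h223 - S22 * h122
    + 2 * S23 * h123 + S33 * h122 ->
  w2233 = 2 * S12 * h223 - S12 * h333 + S13 * h222 - 2 * S13 * h233
    - 2 * S22 * h123 - S23 * h122 + S23 * h133 + 2 * S33 * h123 ->
  w2333 = S12 * h233 + 2 * S13 * h223 - S13 * h333 - S22 * h133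
    - 2 * S23 * h123 + S33 * h133 ->
  w3333 = S13 * h233 - S23 * h133 ->
  0 <= - 4 * s ^+ 3 + 17 * s * q - 15 * r.
Proof.
do 27!move=> ?.
(* The weights 12, 3, 2, 1 are 12 divided by the multinomial coefficients 1, 4, 6, 12 of a ternary
   quartic. After [subst] this is a polynomial identity in the seven free components of [h]. *)
have -> : - 4 * s ^+ 3 + 17 * s * q - 15 * r =
    12 * (w1111 ^+ 2 + w2222 ^+ 2 + w3333 ^+ 2) +
    3 * (w1112 ^+ 2 + w1113 ^+ 2 + w1222 ^+ 2 + w1333 ^+ 2 + w2223 ^+ 2
         + w2333 ^+ 2) +
    2 * (w1122 ^+ 2 + w1133 ^+ 2 + w2233 ^+ 2) +
    (w1123 ^+ 2 + w1223 ^+ 2 + w1233 ^+ 2).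
  by subst; ring.
by do !sos_step.
Qed.

(* [x_ijk] are the coefficients of [det(x, v, h(x,x))], and [p_ijkl] those of
   [20 (x.Sx)^2 + 17 (v.x) h(x,x,x) - 20 s |h(x,x)|^2]. *)
Lemma first_inequality_coords {R : realFieldType}
    {h111 h112 h113 h122 h123 h133 h222 h223 h233 h333 S11 S12 S13 S22 S23 S33
     v1 v2 v3 s q r x111 x112 x113 x122 x123 x133 x222 x223 x233 x333 p1111
     p1112 p1113 p1122 p1123 p1133 p1222 p1223 p1233 p1333 p2222 p2223 p2233
     p2333 p3333 : R} :
  h111 = - (h122 + h133) ->
  h222 = - (h112 + h233) ->
  h333 = - (h113 + h223) ->
  S11 = h111 ^+ 2 + 2 * h112 ^+ 2 + 2 * h113 ^+ 2 + h122 ^+ 2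
    + 2 * h123 ^+ 2 + h133 ^+ 2 ->
  S12 = h111 * h112 + 2 * h112 * h122 + 2 * h113 * h123 + h122 * h222
    + 2 * h123 * h223 + h133 * h233 ->
  S13 = h111 * h113 + 2 * h112 * h123 + 2 * h113 * h133 + h122 * h223
    + 2 * h123 * h233 + h133 * h333 ->
  S22 = h112 ^+ 2 + 2 * h122 ^+ 2 + 2 * h123 ^+ 2 + h222 ^+ 2
    + 2 * h223 ^+ 2 + h233 ^+ 2 ->
  S23 = h112 * h113 + 2 * h122 * h123 + 2 * h123 * h133 + h222 * h223
    + 2 * h223 * h233 + h233 * h333 ->
  S33 = h113 ^+ 2 + 2 * h123 ^+ 2 + 2 * h133 ^+ 2 + h223 ^+ 2
    + 2 * h233 ^+ 2 + h333 ^+ 2 ->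
  v1 = S11 * h111 + 2 * S12 * h112 + 2 * S13 * h113 + S22 * h122
    + 2 * S23 * h123 + S33 * h133 ->
  v2 = S11 * h112 + 2 * S12 * h122 + 2 * S13 * h123 + S22 * h222
    + 2 * S23 * h223 + S33 * h233 ->
  v3 = S11 * h113 + 2 * S12 * h123 + 2 * S13 * h133 + S22 * h223
    + 2 * S23 * h233 + S33 * h333 ->
  s = S11 + S22 + S33 ->
  q = S11 ^+ 2 + S22 ^+ 2 + S33 ^+ 2 + 2 * (S12 ^+ 2 + S13 ^+ 2
    + S23 ^+ 2) ->
  r = S11 ^+ 3 + S22 ^+ 3 + S33 ^+ 3 + 3 * (S11 * (S12 ^+ 2
    + S13 ^+ 2) + S22 * (S12 ^+ 2 + S23 ^+ 2) + S33 * (S13 ^+ 2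
    + S23 ^+ 2)) + 6 * S12 * S13 * S23 ->
  x111 = v2 * h113 - v3 * h112 ->
  x112 = - v1 * h113 + 2 * v2 * h123 + v3 * h111 - 2 * v3 * h122 ->
  x113 = v1 * h112 - v2 * h111 + 2 * v2 * h133 - 2 * v3 * h123 ->
  x122 = - 2 * v1 * h123 + v2 * h223 + 2 * v3 * h112 - v3 * h222 ->
  x123 = 2 * v1 * h122 - 2 * v1 * h133 - 2 * v2 * h112 + 2 * v2 * h233
    + 2 * v3 * h113 - 2 * v3 * h223 ->
  x133 = 2 * v1 * h123 - 2 * v2 * h113 + v2 * h333 - v3 * h233 ->
  x222 = - v1 * h223 + v3 * h122 ->
  x223 = v1 * h222 - 2 * v1 * h233 - v2 * h122 + 2 * v3 * h123 ->
  x233 = 2 * v1 * h223 - v1 * h333 - 2 * v2 * h123 + v3 * h133 ->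
  x333 = v1 * h233 - v2 * h133 ->
  p1111 = 20 * S11 ^+ 2 + 17 * v1 * h111 - 20 * s * (h111 ^+ 2
    + h112 ^+ 2 + h113 ^+ 2) ->
  p1112 = 80 * S11 * S12 + 17 * (3 * v1 * h112 + v2 * h111)
    - 80 * s * (h111 * h112 + h112 * h122 + h113 * h123) ->
  p1113 = 80 * S11 * S13 + 17 * (3 * v1 * h113 + v3 * h111)
    - 80 * s * (h111 * h113 + h112 * h123 + h113 * h133) ->
  p1122 = 40 * (S11 * S22 + 2 * S12 ^+ 2) + 51 * (v1 * h122
    + v2 * h112) - 40 * s * (h111 * h122 + h112 * h222 + 2 * h112 ^+ 2
    + h113 * h223 + 2 * h122 ^+ 2 + 2 * h123 ^+ 2) ->
  p1123 = 80 * (S11 * S23 + 2 * S12 * S13) + 51 * (2 * v1 * h123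
    + v2 * h113 + v3 * h112) - 80 * s * (h111 * h123 + 2 * h112 * h113
    + h112 * h223 + h113 * h233 + 2 * h122 * h123
    + 2 * h123 * h133) ->
  p1133 = 40 * (S11 * S33 + 2 * S13 ^+ 2) + 51 * (v1 * h133
    + v3 * h113) - 40 * s * (h111 * h133 + h112 * h233 + h113 * h333
    + 2 * h113 ^+ 2 + 2 * h123 ^+ 2 + 2 * h133 ^+ 2) ->
  p1222 = 80 * S12 * S22 + 17 * (v1 * h222 + 3 * v2 * h122)
    - 80 * s * (h112 * h122 + h122 * h222 + h123 * h223) ->
  p1223 = 80 * (2 * S12 * S23 + S13 * S22) + 51 * (v1 * h223
    + 2 * v2 * h123 + v3 * h122) - 80 * s * (2 * h112 * h123
    + h113 * h122 + 2 * h122 * h223 + h123 * h222 + 2 * h123 * h233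
    + h133 * h223) ->
  p1233 = 80 * (S12 * S33 + 2 * S13 * S23) + 51 * (v1 * h233
    + v2 * h133 + 2 * v3 * h123) - 80 * s * (h112 * h133
    + 2 * h113 * h123 + h122 * h233 + 2 * h123 * h223 + h123 * h333
    + 2 * h133 * h233) ->
  p1333 = 80 * S13 * S33 + 17 * (v1 * h333 + 3 * v3 * h133)
    - 80 * s * (h113 * h133 + h123 * h233 + h133 * h333) ->
  p2222 = 20 * S22 ^+ 2 + 17 * v2 * h222 - 20 * s * (h122 ^+ 2
    + h222 ^+ 2 + h223 ^+ 2) ->
  p2223 = 80 * S22 * S23 + 17 * (3 * v2 * h223 + v3 * h222)
    - 80 * s * (h122 * h123 + h222 * h223 + h223 * h233) ->
  p2233 = 40 * (S22 * S33 + 2 * S23 ^+ 2) + 51 * (v2 * h233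
    + v3 * h223) - 40 * s * (h122 * h133 + 2 * h123 ^+ 2 + h222 * h233
    + h223 * h333 + 2 * h223 ^+ 2 + 2 * h233 ^+ 2) ->
  p2333 = 80 * S23 * S33 + 17 * (v2 * h333 + 3 * v3 * h233)
    - 80 * s * (h123 * h133 + h223 * h233 + h233 * h333) ->
  p3333 = 20 * S33 ^+ 2 + 17 * v3 * h333 - 20 * s * (h133 ^+ 2
    + h233 ^+ 2 + h333 ^+ 2) ->
  0 <= s * (s ^+ 3 + 3 * s * q - 10 * r).
Proof.
do 40!move=> ?.
pose X2 :=
  6 * (x111 ^+ 2 + x222 ^+ 2 + x333 ^+ 2)
  + 2 * (x112 ^+ 2 + x113 ^+ 2 + x122 ^+ 2 + x133 ^+ 2 + x223 ^+ 2 + x233 ^+ 2)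
  + x123 ^+ 2.
(* The nine squares are the pairings of [p] with the real solid harmonics of
   degree 4, so the trace part of [p] drops out; [Y2] is [560 |Y|^2] and [X2]
   is [6 |det(x, v, h(x,x))|^2]. *)
pose Y2 :=
  2 * (8 * p3333 - 4 * (p1133 + p2233) + 3 * p1111 + p1122 + 3 * p2222) ^+ 2
  + 5 * ((4 * p1333 - 3 * p1113 - p1223) ^+ 2
         + (4 * p2333 - p1123 - 3 * p2223) ^+ 2)
  + 40 * (p1133 - p2233 - p1111 + p2222) ^+ 2
  + 10 * (2 * p1233 - p1112 - p1222) ^+ 2
  + 35 * ((p1113 - p1223) ^+ 2 + (p1123 - p2223) ^+ 2)
  + 70 * (p1111 - p1122 + p2222) ^+ 2
  + 70 * (p1112 - p1222) ^+ 2.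
(* The identity for [s (s^3 + 3 s q - 10 r)] with denominators cleared by 33600 = 70 * 480: its two
   terms on the right are [837/480 X2] and [Y2/33600]. *)
have eY : 70 * (480 * (s * (s ^+ 3 + 3 * s * q - 10 * r)) - 837 * X2) = Y2.
  by rewrite /X2 /Y2; subst; ring.
have X2_ge0 : 0 <= X2 by do !sos_step.
have : 0 <= Y2 by do !sos_step.
rewrite -eY pmulr_rge0 ?ltr0n // subr_ge0 => X2_le.
by rewrite -(pmulr_rge0 _ (ltr0n R 480)) (le_trans _ X2_le) // mulr_ge0.
Qed.

(** * Traces of 3 by 3 matrices and of [S] *)

Lemma big_ord3 (V : nmodType) (F : 'I_3 -> V) :
  \sum_(i < 3) F i = F (inord 0) + F (inord 1) + F (inord 2).
Proof.
rewrite !big_ord_recl big_ord0 addr0 addrA.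
by congr (F _ + F _ + F _); apply/val_inj; rewrite /= inordK.
Qed.

(** The indices are variables governed only by the summation rule, to match the theorem's proof,
    where they are kept abstract. *)
Lemma mxtrace_sqr3 {R : comNzRingType} {A : 'M[R]_3} {i j k : 'I_3} :
  (forall F : 'I_3 -> R, \sum_(l < 3) F l = F i + F j + F k) ->
  (forall l m, A l m = A m l) ->
  \tr (A ^+ 2) = A i i ^+ 2 + A j j ^+ 2 + A k k ^+ 2
                 + 2 * (A i j ^+ 2 + A i k ^+ 2 + A j k ^+ 2).
Proof.
move=> sum3 A_sym; rewrite expr2 /mxtrace sum3 !mxE !sum3.
by rewrite (A_sym j i) (A_sym k i) (A_sym k j); ring.
Qed.

Lemma mxtrace_cube3 {R : comNzRingType} {A : 'M[R]_3} {i j k : 'I_3} :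
  (forall F : 'I_3 -> R, \sum_(l < 3) F l = F i + F j + F k) ->
  (forall l m, A l m = A m l) ->
  \tr (A ^+ 3) = A i i ^+ 3 + A j j ^+ 3 + A k k ^+ 3
                 + 3 * (A i i * (A i j ^+ 2 + A i k ^+ 2)
                        + A j j * (A i j ^+ 2 + A j k ^+ 2)
                        + A k k * (A i k ^+ 2 + A j k ^+ 2))
                 + 6 * A i j * A i k * A j k.
Proof.
move=> sum3 A_sym; rewrite exprS expr2 /mxtrace sum3 !mxE !sum3 !mxE !sum3.
by rewrite (A_sym j i) (A_sym k i) (A_sym k j); ring.
Qed.

Lemma S_mx_sym {R : realType} (h : cubic_components R) i j :
  S_mx h i j = S_mx h j i.
Proof.
by rewrite !mxE; do 2![apply: eq_bigr => ? _]; rewrite mulrC.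
Qed.

Lemma mxtrace_S_mx (R : realType) (h : cubic_components R) :
  \tr (S_mx h) = \sum_(i < 3) \sum_(a < 3) \sum_(b < 3) h a b i ^+ 2.
Proof. by apply: eq_bigr => i _; rewrite mxE. Qed.

Lemma mxtrace_S_mx_ge0 (R : realType) (h : cubic_components R) :
  0 <= \tr (S_mx h).
Proof.
by rewrite mxtrace_S_mx; do 3![apply: sumr_ge0 => ? _]; apply: sqr_ge0.
Qed.

(** The trace is the sum of the squares of all components, so its vanishing forces [h = 0]. This
    serves the case where the factor [s] cannot be cancelled. *)
Lemma mxtrace_S_mx_eq0 {R : realType} {h : cubic_components R} :
  \tr (S_mx h) = 0 -> S_mx h = 0.
Proof.
rewrite mxtrace_S_mx => h2_0.
suff h0 a b i : h a b i = 0.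
  by apply/matrixP => i j; rewrite !mxE !big1 // => a _; rewrite big1 // => b _;
     rewrite h0 mul0r.
have sq_ge0 c d k : 0 <= h c d k ^+ 2 by exact: sqr_ge0.
have sum1_ge0 k c : 0 <= \sum_(d < 3) h c d k ^+ 2 by apply: sumr_ge0.
have sum2_ge0 k : 0 <= \sum_(c < 3) \sum_(d < 3) h c d k ^+ 2.
  by apply: sumr_ge0.
have e2 := psumr_eq0P (fun k _ => sum2_ge0 k) h2_0 (i := i) isT.
have e1 := psumr_eq0P (fun c _ => sum1_ge0 i c) e2 (i := a) isT.
have /eqP := psumr_eq0P (fun d _ => sq_ge0 a d i) e1 (i := b) isT.
by rewrite sqrf_eq0 => /eqP.
Qed.

(** * From tensor components to coordinates *)

Theorem lemma4p1 (R : realType) (h : cubic_components R)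
  (h_sym : totally_symmetric h) (h_tf : trace_free h) :
  let S := S_mx h in
  let s := \tr S in
  let q := \tr (S ^+ 2) in
  let r := \tr (S ^+ 3) in
  0 <= s ^+ 3 + 3 * s * q - 10 * r /\
  0 <= - 4 * s ^+ 3 + 17 * s * q - 15 * r.
Proof.
move=> S s q r.
(* The values of the three indices are forgotten, so that [ring] sees each component of [h] as an
   atom. *)
have [i [j [k sum3]]] : exists i j k : 'I_3,
    forall F : 'I_3 -> R, \sum_(l < 3) F l = F i + F j + F k.
  by exists (inord 0), (inord 1), (inord 2) => F; apply: big_ord3.
have sym12 a b c : h b a c = h a b c by have [-> _] := h_sym a b c.
have sym23 a b c : h a c b = h a b c by have [_ ->] := h_sym a b c.
have perm2 a b : (h a b a = h a a b) * (h b a a = h a a b).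
  by rewrite sym12 sym23.
have perm3 : (h i k j = h i j k) * (h j i k = h i j k) * (h j k i = h i j k)
    * (h k i j = h i j k) * (h k j i = h i j k).
  have e1 : h i k j = h i j k by rewrite sym23.
  have e2 : h j k i = h i j k by rewrite sym23 sym12.
  by rewrite (sym12 i j) (sym12 i k) (sym12 j k) e1 e2.
(* As a rewrite rule this reduces the 27 components to ten representatives, with a repeated index
   placed first. *)
have sortE := (perm3, (perm2 i j, perm2 j i, perm2 i k),
  (perm2 k i, perm2 j k, perm2 k j)).
have tf1 : h i i i = - (h j j i + h k k i).
  by apply/eqP; rewrite -addr_eq0 addrA -(h_tf i) sum3.
have tf2 : h j j j = - (h i i j + h k k j).
  by apply/eqP; rewrite -addr_eq0 addrCA addrA -(h_tf j) sum3.
have tf3 : h k k k = - (h i i k + h j j k).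
  by apply/eqP; rewrite -addr_eq0 addrC -(h_tf k) sum3.
have S_E a b : S a b = \sum_(c < 3) \sum_(d < 3) h c d a * h c d b.
  by rewrite mxE.
have S_entry a b := etrans (S_E a b) (sum3 _).
have s_E : s = S i i + S j j + S k k by apply: sum3.
have q_E := mxtrace_sqr3 sum3 (S_mx_sym h).
have r_E := mxtrace_cube3 sum3 (S_mx_sym h).
split.
  have : 0 <= s * (s ^+ 3 + 3 * s * q - 10 * r).
    (* The trace equations do not mention [h123], so it is given explicitly. The six blanks are the
       entries of [S]; the coefficients of the auxiliary forms are instantiated by [erefl]. *)
    by apply: (first_inequality_coords (h123 := h i j k) tf1 tf2 tf3 _ _ _ _ _ _
      erefl erefl erefl s_E q_E r_E);
      first [exact: erefl | rewrite S_entry !sum3 !sortE; ring].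
  (* If [s = 0], then [S = 0] and every term vanishes; otherwise [s > 0] is cancelled. *)
  have [s0 _|s_neq0] := eqVneq s 0.
    have r0 : r = 0 by rewrite /r /S (mxtrace_S_mx_eq0 s0) expr0n raddf0.
    by rewrite s0 r0 expr0n /= !(mulr0, mul0r) addr0 subr0.
  by rewrite pmulr_rge0 // lt_def s_neq0 mxtrace_S_mx_ge0.
by apply: (second_inequality_coords (h123 := h i j k) tf1 tf2 tf3
    _ _ _ _ _ _ s_E q_E r_E);
  first [exact: erefl | rewrite S_entry !sum3 !sortE; ring].
Qed.
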